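(* Let $q$ be a power of $3$ and let $f$ be a binary quartic form over $\mathbb{F}_q$ with $\Delta(f)\neq0$ and $\jmath(f)=r\ne0$, normalized so that the coefficient of $X^2Y^2$ is $1$. Let $\zeta_f$ be the number of $(x:y)\in PG(1,q)$ such that $f(x,y)$ is a nonzero square in $\mathbb{F}_q$. Then $\zeta_f=\frac{\#\mathcal{E}_r(\mathbb{F}_q)-i}{2}$ if $f\in\mathcal{F}_i$ for $i\in\{1,2,4\}$, and $\zeta_f=\frac{\#\mathcal{E}_r(\mathbb{F}_q)}{2}$ if $f\in\mathcal{F}_2'\cup\mathcal{F}_4'$.
   Context: For $f=z_0X^4+z_1X^3Y+z_2X^2Y^2+z_3XY^3+z_4Y^4$: $\Delta(f)=(z_0z_4-z_1z_3)^3+(z_0z_4-z_1z_3)^2z_2^2-z_2^3(z_0z_3^2+z_4z_1^2-z_0z_2z_4)$ and $\jmath(f)=z_2^6/\Delta(f)$. Types by factorization over $\mathbb{F}_q$: $\mathcal{F}_4$ four linear; $\mathcal{F}_2$ two linear and an irreducible quadratic; $\mathcal{F}_1$ one linear and an irreducible cubic; $\mathcal{F}_4'$ two irreducible quadratics; $\mathcal{F}_2'$ irreducible. For $r\in\mathbb{F}_q^\times$, $\mathcal{E}_r$ is the elliptic curve $S^2=T^3+T^2-r^{-1}$ in $\mathbb{P}^2$, and $\#\mathcal{E}_r(\mathbb{F}_q)$ is its number of $\mathbb{F}_q$-rational points, including the point at infinity. *)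

(* Defs.v *)
From mathcomp Require Export all_boot all_algebra.
From mathcomp Require Export mpoly.

Set Implicit Arguments.
Unset Strict Implicit.
Unset Printing Implicit Defensive.

Import GRing.Theory.
Local Open Scope ring_scope.

(* A point of PG(n, F) is the set of all its vectors of homogeneous
   coordinates, which are nonzero and pairwise proportional. *)
Definition proj_point (F : finFieldType) (n : nat) (v : 'rV[F]_n.+1) :
    {set 'rV[F]_n.+1} :=
  [set c *: v | c : F & c != 0].

Definition PG (F : finFieldType) (n : nat) : {set {set 'rV[F]_n.+1}} :=
  [set proj_point v | v : 'rV[F]_n.+1 & v != 0].

Definition form_eval (F : finFieldType) (n : nat)
    (g : {mpoly F[n.+1]}) (v : 'rV[F]_n.+1) : F :=
  g.@[fun i => v 0 i].

Definition nonzero_square (F : finFieldType) (x : F) : bool :=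
  (x != 0) && [exists a : F, x == a ^+ 2].

(* The condition does not depend on the representative v of P, because
   f (c *: v) = c ^+ 4 * f v for a binary quartic form f. *)
Definition zeta (F : finFieldType) (f : {mpoly F[2]}) : nat :=
  #|[set P in PG F 1 | [exists v in P, nonzero_square (form_eval f v)]]|.

(* The coefficient of X^(4-i) Y^i, where X = 'X_0 and Y = 'X_1. *)
Definition qcoef (F : fieldType) (f : {mpoly F[2]}) (i : nat) : F :=
  f@_(U_(0%R) *+ (4 - i) + U_(1%R) *+ i)%MM.

Definition Delta (F : fieldType) (f : {mpoly F[2]}) : F :=
  let z0 := qcoef f 0 in
  let z1 := qcoef f 1 in
  let z2 := qcoef f 2 in
  let z3 := qcoef f 3 in
  let z4 := qcoef f 4 in
  (z0 * z4 - z1 * z3) ^+ 3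
  + (z0 * z4 - z1 * z3) ^+ 2 * z2 ^+ 2
  - z2 ^+ 3 * (z0 * z3 ^+ 2 + z4 * z1 ^+ 2 - z0 * z2 * z4).

Definition jinv (F : fieldType) (f : {mpoly F[2]}) : F :=
  qcoef f 2 ^+ 6 / Delta f.

Definition mirreducible (F : fieldType) (n : nat) (g : {mpoly F[n]}) : Prop :=
  [/\ g != 0, g \isn't a GRing.unit
    & forall a b : {mpoly F[n]},
        g = a * b -> a \is a GRing.unit \/ b \is a GRing.unit].

(* f is a product of irreducible forms over F whose degrees are listed in ds;
   a scalar factor of f is absorbed in one of the forms. *)
Definition factor_type (F : fieldType) (ds : seq nat) (f : {mpoly F[2]}) :
    Prop :=
  exists gs : seq {mpoly F[2]},
    [/\ size gs = size ds,
        forall i, (i < size ds)%N ->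
          gs`_i \is (nth 0%N ds i).-homog /\ mirreducible gs`_i
      & f = \prod_(g <- gs) g].

Definition F4 (F : fieldType) := factor_type (F := F) [:: 1; 1; 1; 1]%N.
Definition F2 (F : fieldType) := factor_type (F := F) [:: 1; 1; 2]%N.
Definition F1 (F : fieldType) := factor_type (F := F) [:: 1; 3]%N.
Definition F4' (F : fieldType) := factor_type (F := F) [:: 2; 2]%N.
Definition F2' (F : fieldType) := factor_type (F := F) [:: 4]%N.

(* The homogeneous cubic of S^2 = T^3 + T^2 - r^-1 with T = 'X_0, S = 'X_1
   and the homogenizing variable 'X_2. *)
Definition E_cubic (F : fieldType) (r : F) : {mpoly F[3]} :=
  'X_1 ^+ 2 * 'X_2
  - ('X_0 ^+ 3 + 'X_0 ^+ 2 * 'X_2 - r^-1 *: 'X_2 ^+ 3).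

Definition E_points (F : finFieldType) (r : F) : {set {set 'rV[F]_3}} :=
  [set P in PG F 2 | [exists v in P, form_eval (E_cubic r) v == 0]].

(* Main.v *)
Require Import Defs.
From mathcomp Require Import finfield ring.

Set Implicit Arguments.
Unset Strict Implicit.
Unset Printing Implicit Defensive.

Import GRing.Theory.
Local Open Scope ring_scope.

(* Let N be the number of pairs of a point (x : y) and a square root of f(x, y).
   Then N = 2 zeta + (number of zeros of f), and the zeros are read off the
   factorization, since Delta f <> 0 excludes double factors.  It remains to see
   that N is the number of points of E_r.  In characteristic 3 the coefficient of
   X^2 Y^2 and Delta are invariant under the shifts X := X + t Y and the swap of
   X and Y, and so is N.  If f takes a square value, these moves make it the
   coefficient s^2 of X^4.  If s = 0, an affine change of x turns f(x, 1) into
   x^3 + x^2 - Delta, up to a square factor.  If s <> 0, one more shift kills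
   X^3 Y, and the conics z = s x^2 + m sweep out the curve z^2 = f(x, 1), which
   leads back to the case s = 0.  If f takes no square value, a nonsquare
   multiple of f takes only nonzero square values, hence has 2 q affine points,
   while the same conics show that there are at most 2 q - 1. *)

(** * Square roots of the values of a binary quartic *)

Definition quartic (F : fieldType) (a b c d e x y : F) : F :=
  a * x ^+ 4 + b * x ^+ 3 * y + c * x ^+ 2 * y ^+ 2 + d * x * y ^+ 3 + e * y ^+ 4.

(** The polynomial [Delta] as a function of the five coefficients. *)
Definition quartic_disc (F : fieldType) (a b c d e : F) : F :=
  (a * e - b * d) ^+ 3 + (a * e - b * d) ^+ 2 * c ^+ 2
  - c ^+ 3 * (a * d ^+ 2 + e * b ^+ 2 - a * c * e).

Definition nsqrt (F : finFieldType) (u : F) : nat := #|[set s : F | s ^+ 2 == u]|.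

Definition naff (F : finFieldType) (g : F -> F) : nat := \sum_x nsqrt (g x).

(** Summing over all vectors, rather than over the points of the line, makes a linear change of
    variables a mere reindexing. *)
Definition nvec (F : finFieldType) (g : F -> F -> F) : nat :=
  \sum_x \sum_y nsqrt (g x y).

Lemma nsqrtM (F : finFieldType) (c u : F) : c != 0 ->
  nsqrt (c ^+ 2 * u) = nsqrt u.
Proof.
move=> c0; rewrite /nsqrt -[RHS](card_imset _ (mulfI c0)).
apply: eq_card => s; rewrite inE; apply/eqP/imsetP => [su|[t]].
  exists (c^-1 * s); last by rewrite mulVKf.
  by rewrite inE exprMn su exprVn mulKf // expf_neq0.
by rewrite inE => /eqP tu ->; rewrite exprMn tu.
Qed.

Lemma nsqrt0 (F : finFieldType) : nsqrt (0 : F) = 1%N.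
Proof.
rewrite /nsqrt -(cards1 (0 : F)); apply: eq_card => s.
by rewrite !inE expf_eq0.
Qed.

Lemma nsqrtX2 (F : finFieldType) (s : F) : 2%:R != 0 :> F -> s != 0 ->
  nsqrt (s ^+ 2) = 2%N.
Proof.
move=> n2 s0; rewrite /nsqrt.
have -> : [set t : F | t ^+ 2 == s ^+ 2] = [set s; - s].
  by apply/setP=> t; rewrite !inE eqf_sqr.
rewrite cards2 -addr_eq0 -mulr2n -mulr_natr mulf_eq0.
by rewrite (negPf s0) (negPf n2).
Qed.

Lemma nsqrt_le2 (F : finFieldType) (u : F) : (nsqrt u <= 2)%N.
Proof.
rewrite /nsqrt; have [->|[s]] := set_0Vmem [set s : F | s ^+ 2 == u].
  by rewrite cards0.
rewrite inE => /eqP <-.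
have -> : [set t : F | t ^+ 2 == s ^+ 2] = [set s; - s].
  by apply/setP=> t; rewrite !inE eqf_sqr.
by rewrite cards2; case: eqP.
Qed.

Lemma nvec_shift (F : finFieldType) (t : F) (g : F -> F -> F) :
  nvec (fun x y => g (x + t * y) y) = nvec g.
Proof.
rewrite /nvec exchange_big [RHS]exchange_big; apply: eq_bigr => y _.
by rewrite [RHS](reindex_inj (addIr (t * y))).
Qed.

Lemma nvec_swap (F : finFieldType) (g : F -> F -> F) :
  nvec (fun x y => g y x) = nvec g.
Proof. by rewrite /nvec exchange_big. Qed.

Lemma eq_nvec (F : finFieldType) (g h : F -> F -> F) :
  g =2 h -> nvec g = nvec h.
Proof. by move=> gh; apply: eq_bigr => x _; apply: eq_bigr => y _; rewrite gh. Qed.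

(** A scalar k multiplies the quartic by the square (k^2)^2, so the q - 1 vectors of a point
    contribute equally. The summand 1 is the origin, and [nsqrt a] belongs to the point (1 : 0). *)
Lemma nvec_quartic (F : finFieldType) (a b c d e : F) :
  nvec (quartic a b c d e)
  = (1 + #|F|.-1 * (nsqrt a + naff (quartic a b c d e ^~ 1%R)))%N.
Proof.
rewrite /nvec exchange_big (bigD1 0) //= (bigD1 0) //=.
have -> : quartic a b c d e 0 0 = 0 by rewrite /quartic; ring.
rewrite nsqrt0 mulnDr addnA; congr (1 + _ + _)%N.
  rewrite -(cardC1 (0 : F)) -sum_nat_const; apply: eq_bigr => x x0.
  rewrite -[RHS](@nsqrtM _ (x ^+ 2)) ?expf_neq0 //; congr nsqrt.
  by rewrite /quartic; ring.
rewrite -(cardC1 (0 : F)) -sum_nat_const; apply: eq_bigr => y y0.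
rewrite (reindex_inj (mulIf y0)); apply: eq_bigr => x _.
rewrite -(@nsqrtM _ (y ^+ 2) (quartic _ _ _ _ _ x 1)) ?expf_neq0 //; congr nsqrt.
by rewrite /quartic; ring.
Qed.

(** * Intersection with conics *)

(** Completing the square: x |-> 2 A x + B maps the roots onto the square roots of the
    discriminant. *)
Lemma card_quadratic (F : finFieldType) (A B C : F) :
  2%:R != 0 :> F -> A != 0 ->
  #|[set x : F | A * x ^+ 2 + B * x + C == 0]| = nsqrt (B ^+ 2 - 4%:R * A * C).
Proof.
move=> n2 A0; have A20 : 2%:R * A != 0 by rewrite mulf_neq0.
have inj : injective (fun x => 2%:R * A * x + B).
  by move=> x y /addIr /(mulfI A20).
have n4 : 4%:R * A != 0.
  by rewrite (_ : 4%:R = 2%:R * 2%:R) ?mulf_neq0 // -natrM.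
rewrite /nsqrt -[LHS](card_imset _ inj).
apply: eq_card => s; rewrite inE; apply/imsetP/eqP => [[t]|su].
  rewrite inE => /eqP tu ->; apply/eqP; rewrite -subr_eq0.
  by apply/eqP; rewrite -(mulr0 (4%:R * A)) -tu; ring.
exists ((2%:R * A)^-1 * (s - B)); last by rewrite mulVKf // subrK.
set t := _ * (s - B).
have ts : s = 2%:R * A * t + B by rewrite /t mulVKf // subrK.
have E : 4%:R * A * (A * t ^+ 2 + B * t + C) = s ^+ 2 - (B ^+ 2 - 4%:R * A * C).
  by rewrite {1}ts; ring.
by rewrite inE -(mulrI_eq0 _ (mulfI n4)) E su subrr.
Qed.

(** For fixed x, the substitution z = s x^2 + m trades z for m, and the terms in x^4 cancel. *)
Lemma naff_conic (F : finFieldType) (s u c d : F) :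
  naff (fun x => s ^+ 2 * x ^+ 4 + u * x ^+ 2 + c * x + d)
  = (\sum_(m : F) #|[set x : F | ((2%:R * s * m - u) * x ^+ 2 - c * x + (m ^+ 2 - d) == 0)%R]|)%N.
Proof.
transitivity (\sum_(x : F) \sum_(m : F)
    ((2%:R * s * m - u) * x ^+ 2 - c * x + (m ^+ 2 - d) == 0)%R)%N.
  apply: eq_bigr => x _; rewrite /nsqrt -sum1dep_card big_mkcond.
  rewrite (reindex_inj (addrI (s * x ^+ 2))) /=; apply: eq_bigr => m _.
  rewrite -subr_eq0 (_ : _ - _ =
    (2%:R * s * m - u) * x ^+ 2 - c * x + (m ^+ 2 - d)); last by ring.
  by case: eqP.
rewrite exchange_big; apply: eq_bigr => m _.
rewrite -sum1dep_card [RHS]big_mkcond; apply: eq_bigr => x _.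
by case: eqP.
Qed.

(** * Arithmetic in characteristic 3 *)

Lemma char3_numerals (F : fieldType) : 3%:R = 0 :> F ->
  (2%:R = -1 :> F) * (4%:R = 1 :> F) * (5%:R = -1 :> F) * (6%:R = 0 :> F)
  * (7%:R = 1 :> F) * (8%:R = -1 :> F) * (9%:R = 0 :> F)
  * (- 2%:R = 1 :> F) * (- 3%:R = 0 :> F) * (- 4%:R = -1 :> F)
  * (- 5%:R = 1 :> F) * (- 6%:R = 0 :> F) * (- 7%:R = -1 :> F)
  * (- 8%:R = 1 :> F) * (- 9%:R = 0 :> F).
Proof.
move=> h3.
have h2 : 2%:R = -1 :> F by apply/eqP; rewrite -addr_eq0 natr1 h3.
have D n : (n + 3)%:R = n%:R :> F by rewrite natrD h3 addr0.
rewrite (D 6%N) (D 5%N) (D 4%N) (D 3%N) (D 2%N) (D 1%N) h3 h2.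
by rewrite opprK oppr0.
Qed.

(* [ring] only rewrites a coefficient that coincides with the left-hand side
   of a hypothesis, hence one hypothesis per numeral. *)
Ltac ring_char3 h3 :=
  let h2 := fresh in let h4 := fresh in let h5 := fresh in
  let h6 := fresh in let h7 := fresh in let h8 := fresh in
  let h9 := fresh in let g2 := fresh in let g3 := fresh in
  let g4 := fresh in let g5 := fresh in let g6 := fresh in
  let g7 := fresh in let g8 := fresh in let g9 := fresh in
  have [[[[[[[[[[[[[[h2 h4] h5] h6] h7] h8] h9] g2] g3] g4] g5] g6] g7] g8] g9] :=
    char3_numerals h3;
  ring: h3 h2 h4 h5 h6 h7 h8 h9 g2 g3 g4 g5 g6 g7 g8 g9.

Lemma char3_two_neq0 (F : fieldType) : 3%:R = 0 :> F -> 2%:R != 0 :> F.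
Proof.
move=> h3; have /eqP : 2%:R + 1 = 0 :> F by rewrite natr1.
rewrite addr_eq0 => /eqP ->.
by rewrite oppr_eq0 oner_eq0.
Qed.

(** * Quartics whose leading coefficient is a square *)

(** For all m but one, the conic z = s x^2 + m meets the curve in the roots of a quadratic whose
    discriminant stands under [nsqrt] (recall 4 = 1). The exceptional m has one solution less than
    the formula says, whence the successor. *)
Lemma naff_quartic_conic (F : finFieldType) (s u c d : F) :
  3%:R = 0 :> F -> s != 0 -> quartic_disc (s ^+ 2) 0 u c d != 0 ->
  (naff (quartic (s ^+ 2) 0 u c d ^~ 1%R)).+1
  = (\sum_m nsqrt (c ^+ 2 - (2%:R * s * m - u) * (m ^+ 2 - d))%R)%N.
Proof.
move=> h3 s0 D0; have n2 := char3_two_neq0 h3.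
(* The value of m at which the coefficient of x^2 vanishes. *)
pose m0 := (2%:R * s)^-1 * u.
have s20 : 2%:R * s != 0 by rewrite mulf_neq0.
have m0E : u = 2%:R * s * m0 by rewrite /m0 mulVKf.
have -> : naff (quartic (s ^+ 2) 0 u c d ^~ 1)
    = naff (fun x => s ^+ 2 * x ^+ 4 + u * x ^+ 2 + c * x + d).
  by apply: eq_bigr => x _; congr nsqrt; rewrite /quartic; ring.
rewrite naff_conic (bigD1 m0) //= [RHS](bigD1 m0) //= -addSn.
congr (_ + _)%N; last first.
  apply: eq_bigr => m mm0.
  have A0 : 2%:R * s * m - u != 0.
    by rewrite m0E -mulrBr mulf_neq0 // subr_eq0.
  transitivity #|[set x : F | (2%:R * s * m - u) * x ^+ 2 + (- c) * x + (m ^+ 2 - d) == 0]|.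
    by apply: eq_card => x; rewrite !inE mulNr.
  by rewrite card_quadratic //; congr nsqrt; ring_char3 h3.
(* At [m0] the equation is c x = m0^2 - d. If c = 0 it has no solution, because d = m0^2 would
   annihilate the discriminant, while 0 has one square root. If c <> 0 it has one solution, while
   c^2 has two square roots. *)
rewrite m0E subrr mul0r subr0; have [c0|c0] := eqVneq c 0.
  rewrite c0 expr0n nsqrt0 (_ : [set x | _] = set0) ?cards0 //.
  apply/setP=> x; rewrite !inE !mul0r subr0 add0r; apply/negP => /eqP m0d.
  case/negP: D0; have dE : d = m0 ^+ 2 by apply/eqP; rewrite eq_sym -subr_eq0 m0d.
  have uE : u = - (s * m0) by rewrite m0E; ring_char3 h3.
  by apply/eqP; rewrite /quartic_disc c0 dE uE; ring_char3 h3.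
rewrite nsqrtX2 // (_ : [set x | _] = [set c^-1 * (m0 ^+ 2 - d)]) ?cards1 //.
apply/setP=> x; rewrite !inE mul0r sub0r addrC subr_eq0 eq_sym.
by rewrite -[RHS](inj_eq (mulfI c0)) mulVKf.
Qed.

(** The successor accounts for the point at infinity. *)
Definition ncurve (F : finFieldType) (D : F) : nat :=
  (naff (fun x => x ^+ 3 + x ^+ 2 - D)).+1.

(** The points of the double cover z^2 = f(x, y) of the projective line; [nsqrt a] counts those over
    (1 : 0). *)
Definition npoints (F : finFieldType) (a b c d e : F) : nat :=
  (nsqrt a + naff (quartic a b c d e ^~ 1%R))%N.

Lemma npoints_root (F : finFieldType) (b d e : F) :
  3%:R = 0 :> F -> b != 0 ->
  npoints 0 b 1 d e = ncurve (quartic_disc 0 b 1 d e).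
Proof.
move=> h3 b0; rewrite /npoints /ncurve nsqrt0 add1n; congr _.+1.
(* With T = b (x - d), b^2 f(x, 1) becomes T^3 + T^2 - D; the shift -b d equals b d / 2 and so
   yields the linear term. *)
rewrite [RHS](reindex_inj (mulfI b0)) [RHS](reindex_inj (addIr (- d))).
apply: eq_bigr => x _ /=; rewrite -(@nsqrtM _ b) //; congr nsqrt.
by rewrite /quartic /quartic_disc; ring_char3 h3.
Qed.

Lemma npoints_square_depressed (F : finFieldType) (s d e : F) :
  3%:R = 0 :> F -> s != 0 -> quartic_disc (s ^+ 2) 0 1 d e != 0 ->
  npoints (s ^+ 2) 0 1 d e = ncurve (quartic_disc (s ^+ 2) 0 1 d e).
Proof.
move=> h3 s0 D0; have n2 := char3_two_neq0 h3.
(* The discriminants of the conics form the cubic s m^3 + m^2 - s e m + d^2 - e in m, which is a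
   quartic form with leading coefficient 0 and the same [quartic_disc]. *)
transitivity (npoints 0 s 1 (- s * e) (d ^+ 2 - e)).
  (* Of the two points over (1 : 0), one matches that of the cubic and the other supplies the
     successor in [naff_quartic_conic]. *)
  rewrite /npoints nsqrtX2 // nsqrt0 add2n -addn1 addnC; congr (1 + _)%N.
  rewrite naff_quartic_conic //; apply: eq_bigr => m _; congr nsqrt.
  by rewrite /quartic; ring_char3 h3.
rewrite npoints_root //; congr ncurve.
by rewrite /quartic_disc; ring_char3 h3.
Qed.

Lemma naff_square_quartic_lt (F : finFieldType) (s u d e : F) :
  3%:R = 0 :> F -> s != 0 -> quartic_disc (s ^+ 2) 0 u d e != 0 ->
  (naff (quartic (s ^+ 2) 0 u d e ^~ 1%R) < 2 * #|F|)%N.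
Proof.
move=> h3 s0 D0; rewrite naff_quartic_conic // mulnC -sum_nat_const.
by apply: leq_sum => m _; apply: nsqrt_le2.
Qed.

(** * Reduction to a square leading coefficient *)

Lemma sum_nsqrt (F : finFieldType) : (\sum_(u : F) nsqrt u)%N = #|F|.
Proof.
rewrite -sum1_card [RHS](partition_big (fun s : F => s ^+ 2) predT) //=.
by apply: eq_bigr => u _; rewrite /nsqrt -sum1dep_card.
Qed.

(** The sum is at most 2, since u and n u cannot both be nonzero squares. Over the whole field each
    of the two terms adds up to q, so equality holds everywhere. *)
Lemma nsqrt_twist (F : finFieldType) (n u : F) :
  2%:R != 0 :> F -> nsqrt n = 0%N -> (nsqrt u + nsqrt (n * u)%R)%N = 2%N.
Proof.
move=> n2 nn.
have n0 : n != 0 by apply/eqP => n0; rewrite n0 nsqrt0 in nn.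
have le2 v : (nsqrt v + nsqrt (n * v)%R <= 2)%N.
  have [->|v0] := eqVneq v 0; first by rewrite mulr0 nsqrt0.
  have [E|[s sv]] := set_0Vmem [set s : F | s ^+ 2 == v].
    by rewrite {1}/nsqrt E cards0 nsqrt_le2.
  have [E|[t tv]] := set_0Vmem [set t : F | t ^+ 2 == n * v].
    by rewrite {2}/nsqrt E cards0 addn0 nsqrt_le2.
  move: sv tv; rewrite !inE => /eqP sv /eqP tv.
  have /card0_eq/(_ (t / s)) := nn; rewrite !inE expr_div_n sv tv mulfK //.
  by rewrite eqxx.
have sumn : (\sum_(v : F) nsqrt (n * v)%R)%N = #|F|.
  by rewrite -[RHS]sum_nsqrt [RHS](reindex_inj (mulfI n0)).
have := leqif_sum (fun v (_ : true) => leqif_eq (le2 v)).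
case=> _; rewrite big_split /= sum_nsqrt.
rewrite sumn sum_nat_const muln2 addnn eqxx.
by move=> /esym/forallP/(_ u) /eqP.
Qed.

Lemma finField_card_pred_gt0 (F : finFieldType) : (0 < #|F|.-1)%N.
Proof. by rewrite -(cardC1 (0 : F)); apply/card_gt0P; exists 1; rewrite inE oner_eq0. Qed.

Lemma npoints_nvec (F : finFieldType) (a b c d e a' b' c' d' e' : F) :
  nvec (quartic a b c d e) = nvec (quartic a' b' c' d' e') ->
  npoints a b c d e = npoints a' b' c' d' e'.
Proof.
rewrite !nvec_quartic => /addnI /eqP.
by rewrite eqn_pmul2l ?finField_card_pred_gt0 // => /eqP.
Qed.

Lemma npoints_swap (F : finFieldType) (a b c d e : F) :
  npoints e d c b a = npoints a b c d e.
Proof.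
apply: npoints_nvec; rewrite -nvec_swap; apply: eq_nvec => x y.
by rewrite /quartic; ring.
Qed.

(** The coefficient c survives because 6 a t^2 + 3 b t = 0. The last coefficient becomes f(t, 1),
    which a swap can bring to the front. *)
Lemma npoints_shift (F : finFieldType) (t a b c d e : F) : 3%:R = 0 :> F ->
  npoints a (b + a * t) c (d + 2%:R * c * t + a * t ^+ 3) (quartic a b c d e t 1)
  = npoints a b c d e.
Proof.
move=> h3; apply: npoints_nvec; rewrite -[RHS](nvec_shift t).
by apply: eq_nvec => x y; rewrite /quartic; ring_char3 h3.
Qed.

Lemma quartic_disc_swap (F : fieldType) (a b c d e : F) :
  quartic_disc e d c b a = quartic_disc a b c d e.
Proof. by rewrite /quartic_disc; ring. Qed.

Lemma quartic_disc_shift (F : fieldType) (t a b c d e : F) : 3%:R = 0 :> F ->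
  quartic_disc a (b + a * t) c (d + 2%:R * c * t + a * t ^+ 3)
    (quartic a b c d e t 1)
  = quartic_disc a b c d e.
Proof.
move=> h3; rewrite /quartic_disc.
set d' := d + _ + _; set e' := quartic _ _ _ _ _ _ _.
(* The shift turns I into I + c w and adds w^3 + 2 I w + c w^2 to the last bracket; the two changes
   cancel in the discriminant. *)
pose I := a * e - b * d; pose w := b * t - a * t ^+ 2.
have -> : a * e' - (b + a * t) * d' = I + c * w.
  by rewrite /e' /d' /I /w /quartic; ring_char3 h3.
have -> : a * d' ^+ 2 + e' * (b + a * t) ^+ 2 - a * c * e'
    = a * d ^+ 2 + e * b ^+ 2 - a * c * e + w ^+ 3 + 2%:R * I * w + c * w ^+ 2.
  by rewrite /e' /d' /I /w /quartic; ring_char3 h3.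
by rewrite -/I; ring_char3 h3.
Qed.

Lemma npoints_square_lead (F : finFieldType) (s b d e : F) :
  3%:R = 0 :> F -> quartic_disc (s ^+ 2) b 1 d e != 0 ->
  npoints (s ^+ 2) b 1 d e = ncurve (quartic_disc (s ^+ 2) b 1 d e).
Proof.
move=> h3; have [->|s0] := eqVneq s 0.
  rewrite expr0n /= => D0; apply: npoints_root => //.
  (* If b also vanishes, Y^2 divides the form and the discriminant is 0. *)
  apply: contraNneq D0 => ->.
  by apply/eqP; rewrite /quartic_disc; ring.
have s20 : s ^+ 2 != 0 by rewrite expf_neq0.
(* This shift kills the coefficient of X^3 Y. *)
rewrite -(@npoints_shift _ (- (s ^+ 2)^-1 * b)) //.
rewrite -(@quartic_disc_shift _ (- (s ^+ 2)^-1 * b)) //.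
rewrite [b + _](_ : _ = 0); last by rewrite mulNr mulrN mulVKf // subrr.
exact: npoints_square_depressed.
Qed.

Lemma quartic_square_value (F : finFieldType) (a b c d e : F) :
  3%:R = 0 :> F -> quartic_disc a b c d e != 0 ->
  nsqrt a != 0%N \/ exists t, nsqrt (quartic a b c d e t 1) != 0%N.
Proof.
move=> h3 D0; have n2 := char3_two_neq0 h3.
have [a0|] := eqVneq (nsqrt a) 0%N; last by left.
right; apply/existsP; apply: contraT; rewrite negb_exists => /forallP f0.
have an0 : a != 0 by apply: contra_eq_neq a0 => ->; rewrite nsqrt0.
pose t := - a^-1 * b.
(* The leading coefficient a is itself a nonsquare, so a f has two square roots over each of the q +
   1 points. *)
have full : npoints (a ^+ 2) (a * b) (a * c) (a * d) (a * e) = (2 + 2 * #|F|)%N.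
  rewrite /npoints nsqrtX2 // mulnC -sum_nat_const; congr (2 + _)%N.
  apply: eq_bigr => x _; rewrite -[RHS](nsqrt_twist (quartic a b c d e x 1) n2 a0).
  rewrite (eqP (negbNE (f0 x))) add0n; congr nsqrt.
  by rewrite /quartic; ring.
have D1 : quartic_disc (a ^+ 2) (a * b) (a * c) (a * d) (a * e) != 0.
  rewrite (_ : quartic_disc _ _ _ _ _ = a ^+ 6 * quartic_disc a b c d e).
    by rewrite mulf_neq0 ?expf_neq0.
  by rewrite /quartic_disc; ring.
have depressed : a * b + a ^+ 2 * t = 0.
  by rewrite /t; field.
move: full D1; rewrite -(@npoints_shift _ t) // -(@quartic_disc_shift _ t) //.
rewrite depressed /npoints nsqrtX2 // => /addnI full D1.
by have := naff_square_quartic_lt h3 an0 D1; rewrite full ltnn.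
Qed.

Lemma npoints_ncurve (F : finFieldType) (a b d e : F) :
  3%:R = 0 :> F -> quartic_disc a b 1 d e != 0 ->
  npoints a b 1 d e = ncurve (quartic_disc a b 1 d e).
Proof.
move=> h3 D0.
have lead (x y z w : F) : nsqrt x != 0%N -> quartic_disc x y 1 z w != 0 ->
    npoints x y 1 z w = ncurve (quartic_disc x y 1 z w).
  rewrite cards_eq0 => /set0Pn[s]; rewrite inE => /eqP <-.
  exact: npoints_square_lead.
have [a1|[t t1]] := quartic_square_value h3 D0; first exact: lead.
rewrite -(npoints_shift t) // -(quartic_disc_shift t) //.
rewrite -npoints_swap -quartic_disc_swap; apply: lead => //.
by rewrite quartic_disc_swap quartic_disc_shift.
Qed.

(** * Points of projective space as sets of vectors *)

Lemma proj_point_refl (F : finFieldType) n (v : 'rV[F]_n.+1) :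
  v \in proj_point v.
Proof. by apply/imsetP; exists 1; rewrite ?inE ?oner_eq0 // scale1r. Qed.

Lemma eq_proj_point (F : finFieldType) n (v w : 'rV[F]_n.+1) :
  (proj_point w == proj_point v) = (w \in proj_point v).
Proof.
apply/eqP/idP => [<-|/imsetP[c]]; first exact: proj_point_refl.
rewrite inE => c0 ->; apply/setP=> u; apply/imsetP/imsetP => -[d]; rewrite inE => d0 ->.
  by exists (d * c); rewrite ?inE ?mulf_neq0 // scalerA.
exists (d / c); first by rewrite inE mulf_neq0 ?invr_neq0.
by rewrite scalerA divfK.
Qed.

Lemma card_proj_point (F : finFieldType) n (v : 'rV[F]_n.+1) : v != 0 ->
  #|proj_point v| = #|F|.-1.
Proof.
move=> v0; rewrite card_imset.
  by rewrite -(cardC1 (0 : F)); apply: eq_card => c; rewrite !inE.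
move=> c d /eqP; rewrite -subr_eq0 -scalerBl scaler_eq0 (negPf v0) orbF subr_eq0.
by move/eqP.
Qed.

(** A point consists of q - 1 nonzero vectors, and A is constant on it. Point counts are thereby
    compared as vector counts. *)
Lemma card_cone (F : finFieldType) n (A : pred 'rV[F]_n.+1) :
  (forall c v, c != 0 -> A (c *: v) = A v) ->
  #|[set v | (v != 0) && A v]|
  = (#|F|.-1 * #|[set P in PG F n | [exists v in P, A v]]|)%N.
Proof.
move=> Ascale.
have scale0 (c : F) (v : 'rV[F]_n.+1) : c != 0 -> (c *: v == 0) = (v == 0).
  by move=> c0; rewrite scaler_eq0 (negPf c0).
have -> : [set P in PG F n | [exists v in P, A v]]
    = @proj_point F n @: [set v | (v != 0) && A v].
  apply/setP=> P; rewrite inE; apply/andP/imsetP => [[/imsetP[v]]|[v]].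
    rewrite inE => v0 -> /existsP[w /andP[/imsetP[c]]]; rewrite inE => c0 ->.
    by rewrite Ascale // => Av; exists v; rewrite // inE v0.
  rewrite inE => /andP[v0 Av] ->; split; first by apply: imset_f; rewrite inE.
  by apply/existsP; exists v; rewrite proj_point_refl.
rewrite -sum1_card (partition_big_imset (@proj_point F n)) /= mulnC -sum_nat_const.
apply: eq_bigr => P /imsetP[v]; rewrite inE => /andP[v0 Av] ->.
rewrite -(card_proj_point v0) -sum1_card; apply: eq_bigl => w.
rewrite inE eq_proj_point andb_idl // => /imsetP[c]; rewrite inE => c0 ->.
by rewrite scale0 // v0 Ascale.
Qed.

(** * The counts [zeta] and [E_points] *)

Lemma nsqrtE (F : finFieldType) (u : F) : 2%:R != 0 :> F ->
  nsqrt u = (2 * nonzero_square u + (u == 0)%R)%N.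
Proof.
move=> n2; rewrite /nonzero_square; have [->|u0] /= := eqVneq u 0.
  by rewrite nsqrt0.
case: existsP => [[s /eqP us]|no]; last first.
  rewrite /nsqrt (_ : [set s | _] = set0) ?cards0 //.
  by apply/setP=> s; rewrite !inE; apply/negP=> us; apply: no; exists s; rewrite eq_sym.
by rewrite us nsqrtX2 //; apply: contraNneq u0 => s0; rewrite us s0 expr0n.
Qed.

Lemma row2_bij (F : finFieldType) :
  bijective (fun v : 'rV[F]_2 => (v 0 0, v 0 1)).
Proof.
exists (fun p => \row_i if i == 0 then p.1 else p.2) => [v|[x y]].
  apply/rowP => i; rewrite mxE; case: i => [[|[|//]] i] /=; congr (v 0 _);
    exact: val_inj.
by rewrite !mxE.
Qed.

Lemma row3_bij (F : finFieldType) :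
  bijective (fun v : 'rV[F]_3 => (v 0 0, (v 0 1, v 0 (2%:R : 'I_3)))).
Proof.
exists (fun p => \row_i if i == 0 then p.1 else
                         if i == 1 then p.2.1 else p.2.2) => [v|[x [y z]]].
  apply/rowP => i; rewrite mxE; case: i => [[|[|[|//]]] i] /=; congr (v 0 _);
    exact: val_inj.
by rewrite !mxE.
Qed.

Definition proj_zeros (F : finFieldType) n (g : {mpoly F[n.+1]}) :
    {set {set 'rV[F]_n.+1}} :=
  [set P in PG F n | [exists v in P, form_eval g v == 0]].

Lemma nonzero_squareM (F : finFieldType) (c u : F) : c != 0 ->
  nonzero_square (c ^+ 2 * u) = nonzero_square u.
Proof.
move=> c0; rewrite /nonzero_square mulf_eq0 expf_eq0 (negPf c0) /=.
congr (_ && _); apply/existsP/existsP => -[a /eqP aE].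
  exists (a / c); rewrite expr_div_n -aE mulrC mulKf // expf_neq0 //.
by exists (c * a); rewrite aE exprMn.
Qed.

Lemma zeta_npoints (F : finFieldType) (f : {mpoly F[2]}) (a b c d e : F) :
  2%:R != 0 :> F ->
  (forall v, form_eval f v = quartic a b c d e (v 0 0) (v 0 1)) ->
  (2 * zeta f + #|proj_zeros f|)%N = npoints a b c d e.
Proof.
move=> n2 fE.
have fZ (k : F) v : form_eval f (k *: v) = (k ^+ 2) ^+ 2 * form_eval f v.
  by rewrite !fE !mxE /quartic; ring.
have k2 (k : F) : k != 0 -> (k ^+ 2) ^+ 2 != 0 by move=> k0; rewrite !expf_neq0.
have sqZ k v : k != 0 -> nonzero_square (form_eval f (k *: v)) =
    nonzero_square (form_eval f v).
  by move=> k0; rewrite fZ nonzero_squareM // expf_neq0.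
have zeroZ k v : k != 0 -> (form_eval f (k *: v) == 0) = (form_eval f v == 0).
  by move=> k0; rewrite fZ mulf_eq0 (negPf (k2 k k0)).
(* Multiplying by q - 1 and adding 1 for the origin turns both sides into sums over vectors. *)
apply/eqP; rewrite -(eqn_pmul2l (finField_card_pred_gt0 F)).
rewrite -(eqn_add2l 1) -nvec_quartic mulnDr mulnCA -(card_cone sqZ) -(card_cone zeroZ).
rewrite -!sum1dep_card !big_mkcondr big_distrr /= -big_split /= /nvec pair_big /=.
rewrite [X in _ == X](reindex _ (onW_bij _ (row2_bij F))) /=.
rewrite [X in _ == X](bigD1 0) //= -fE.
rewrite fE !mxE (_ : quartic _ _ _ _ _ 0 0 = 0) ?nsqrt0; last by rewrite /quartic; ring.
rewrite eqn_add2l; apply/eqP/eq_bigr => v v0.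
by rewrite -fE nsqrtE //; do 2 case: ifP.
Qed.

Lemma form_eval_E_cubic (F : finFieldType) (r : F) (v : 'rV[F]_3) :
  let T := v 0 0 in let S := v 0 1 in let Z := v 0 (2%:R : 'I_3) in
  form_eval (E_cubic r) v = S ^+ 2 * Z - (T ^+ 3 + T ^+ 2 * Z - r^-1 * Z ^+ 3).
Proof.
by rewrite /form_eval /E_cubic !(mevalB, mevalD, mevalM, mevalZ, rmorphXn, mevalXU) /=.
Qed.

(** The cone over the cubic is sliced by Z: the slice Z = 0 consists of the q vectors (0, S, 0), and
    each of the q - 1 other slices is a scaled copy of the affine curve. *)
Lemma card_E_points (F : finFieldType) (r : F) : #|E_points r| = ncurve r^-1.
Proof.
have cone (c : F) v : c != 0 ->
    (form_eval (E_cubic r) (c *: v) == 0) = (form_eval (E_cubic r) v == 0).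
  move=> c0; rewrite !form_eval_E_cubic !mxE.
  rewrite -[RHS](mulrI_eq0 _ (mulfI (expf_neq0 3 c0))); congr (_ == 0).
  by ring.
apply/eqP; rewrite -(eqn_pmul2l (finField_card_pred_gt0 F)) -(card_cone cone).
pose h (T S Z : F) := S ^+ 2 * Z - (T ^+ 3 + T ^+ 2 * Z - r^-1 * Z ^+ 3).
have full : (\sum_(v : 'rV[F]_3) (form_eval (E_cubic r) v == 0)%R)%N
    = (\sum_Z \sum_T \sum_S (h T S Z == 0)%R)%N.
  transitivity (\sum_(p : F * (F * F)) (h p.1 p.2.1 p.2.2 == 0)%R)%N.
    rewrite [RHS](reindex _ (onW_bij _ (row3_bij F))) /=.
    by apply: eq_bigr => v _; rewrite form_eval_E_cubic.
  rewrite -(pair_bigA _ (fun T p => nat_of_bool (h T p.1 p.2 == 0)%R)) /=.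
  rewrite [RHS]exchange_big; apply: eq_bigr => T _.
  by rewrite -(pair_bigA _ (fun S Z => nat_of_bool (h T S Z == 0)%R)) exchange_big.
have infinity : (\sum_T \sum_S (h T S 0 == 0)%R)%N = #|F|.
  rewrite (bigD1 0) //= [X in (_ + X)%N]big1 ?addn0 => [|T T0].
    rewrite -sum1_card; apply: eq_bigr => S _.
    by rewrite (_ : h _ _ _ = 0) ?eqxx // /h; ring.
  apply: big1 => S _; rewrite (_ : h _ _ _ = - T ^+ 3); last by rewrite /h; ring.
  by rewrite oppr_eq0 expf_eq0 (negPf T0).
have affine Z : Z != 0 -> (\sum_T \sum_S (h T S Z == 0)%R)%N
    = naff (fun x => x ^+ 3 + x ^+ 2 - r^-1).
  move=> Z0; rewrite (reindex_inj (mulfI Z0)); apply: eq_bigr => T _.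
  rewrite (reindex_inj (mulfI Z0)) /nsqrt -sum1dep_card [RHS]big_mkcond.
  apply: eq_bigr => S _.
  rewrite (_ : h _ _ _ = Z ^+ 3 * (S ^+ 2 - (T ^+ 3 + T ^+ 2 - r^-1))); last first.
    by rewrite /h; ring.
  by rewrite mulf_eq0 expf_eq0 (negPf Z0) /= subr_eq0; case: eqP.
move: full; rewrite (bigD1 0) //= [RHS](bigD1 0) //= infinity.
rewrite (eq_bigr _ affine) sum_nat_const (cardC1 (0 : F)) form_eval_E_cubic !mxE.
rewrite (_ : _ - _ = 0) ?eqxx; last by ring.
have cardE : #|F| = #|F|.-1.+1 by move: (finField_card_pred_gt0 F); case: #|F|.
rewrite [X in _ = (X + _)%N]cardE /ncurve mulnS addSn add1n => -[] <-.
rewrite -sum1dep_card big_mkcondr /=; apply/eqP/eq_bigr => v _.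
by case: eqP.
Qed.

(** * Binary forms and their coefficients *)

Definition bmon (d i : nat) : 'X_{1..2} :=
  (U_(0%R) *+ (d - i) + U_(1%R) *+ i)%MM.

Lemma bmon0 d i : bmon d i 0 = (d - i)%N.
Proof. by rewrite mnmDE !mulmnE !mnm1E mul1n mul0n addn0. Qed.

Lemma bmon1 d i : bmon d i 1 = i.
Proof. by rewrite mnmDE !mulmnE !mnm1E mul1n mul0n. Qed.

Lemma mdeg2E (m : 'X_{1..2}) : mdeg m = (m 0%R + m 1%R)%N.
Proof.
rewrite mdegE big_ord_recl big_ord1; congr (_ + m _)%N.
exact: val_inj.
Qed.

Lemma mdeg_bmon d i : (i <= d)%N -> mdeg (bmon d i) = d.
Proof. by move=> id; rewrite mdeg2E bmon0 bmon1 subnK. Qed.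

Lemma bmon_mdeg (m : 'X_{1..2}) : bmon (mdeg m) (m 1%R) = m.
Proof.
apply/mnmP=> i; have [->|->] : i = 0 \/ i = 1.
- by case: i => [[|[|//]] i]; [left | right]; apply: val_inj.
- by rewrite bmon0 mdeg2E addnK.
- by rewrite bmon1.
Qed.

Lemma mpolyX_bmon (R : comNzRingType) d i :
  'X_[bmon d i] = 'X_0 ^+ (d - i) * 'X_1 ^+ i :> {mpoly R[2]}.
Proof. by rewrite mpolyXD !mpolyXn. Qed.

(** A monomial of degree d in two variables is determined by its exponent of Y. *)
Lemma binary_form_expand (R : comNzRingType) d (g : {mpoly R[2]}) :
  g \is d.-homog ->
  g = \sum_(i < d.+1) g@_(bmon d i) *: ('X_0 ^+ (d - i) * 'X_1 ^+ i).
Proof.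
move=> gd; apply/mpolyP => m; rewrite raddf_sum /=.
under eq_bigr => i _ do rewrite -mpolyX_bmon mcoeffZ mcoeffX.
have [md|md] := eqVneq (mdeg m) d; last first.
  rewrite (dhomog_nemf_coeff gd md) big1 // => i _.
  rewrite (_ : _ == _ = false) ?mulr0 //; apply: contraNF md => /eqP <-.
  by rewrite mdeg_bmon // -ltnS.
have m1d : (m 1%R < d.+1)%N by rewrite ltnS -md mdeg2E leq_addl.
have mE : bmon d (m 1) = m by rewrite -md bmon_mdeg.
rewrite (bigD1 (Ordinal m1d)) //= mE eqxx mulr1 big1 ?addr0 // => i.
move=> im; rewrite (_ : _ == _ = false) ?mulr0 //; apply: contraNF im => /eqP im.
by rewrite -val_eqE /= -im bmon1.
Qed.

Lemma qcoef_sum (F : fieldType) (z : nat -> F) j : (j < 5)%N ->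
  qcoef (\sum_(i < 5) z i *: ('X_0 ^+ (4 - i) * 'X_1 ^+ i)) j = z j.
Proof.
move=> j5; rewrite /qcoef raddf_sum /= (bigD1 (Ordinal j5)) //= big1 => [|i ij].
  by rewrite -mpolyX_bmon mcoeffZ mcoeffX eqxx mulr1 addr0.
rewrite -mpolyX_bmon mcoeffZ mcoeffX (_ : _ == _ = false) ?mulr0 //.
apply: contraNF ij => /eqP /(congr1 (fun m : 'X_{1..2} => m 1)).
by rewrite !bmon1 -val_eqE /= => ->.
Qed.

Lemma form_eval_binary (F : finFieldType) d (g : {mpoly F[2]}) (v : 'rV[F]_2) :
  g \is d.-homog ->
  form_eval g v
  = \sum_(i < d.+1) g@_(bmon d i) * (v 0 0 ^+ (d - i) * v 0 1 ^+ i).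
Proof.
move=> /binary_form_expand gE; rewrite {1}gE /form_eval raddf_sum /=.
by apply: eq_bigr => i _; rewrite mevalZ mevalM !rmorphXn /= !mevalXU.
Qed.

Lemma form_eval_quartic (F : finFieldType) (f : {mpoly F[2]}) (v : 'rV[F]_2) :
  f \is 4.-homog ->
  form_eval f v = quartic (qcoef f 0) (qcoef f 1) (qcoef f 2) (qcoef f 3)
    (qcoef f 4) (v 0 0) (v 0 1).
Proof.
move=> f4; rewrite (form_eval_binary v f4) !big_ord_recl big_ord0.
by rewrite /quartic /qcoef /bmon /=; ring.
Qed.

Lemma linear_formE (R : comNzRingType) (g : {mpoly R[2]}) : g \is 1.-homog ->
  exists a b : R, g = a%:MP * 'X_0 + b%:MP * 'X_1.
Proof.
move=> /binary_form_expand ->; exists g@_(bmon 1 0), g@_(bmon 1 1).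
by rewrite !big_ord_recl big_ord0 -!mul_mpolyC /=; ring.
Qed.

Lemma quadratic_formE (R : comNzRingType) (g : {mpoly R[2]}) : g \is 2.-homog ->
  exists a b c : R,
    g = a%:MP * 'X_0 ^+ 2 + b%:MP * ('X_0 * 'X_1) + c%:MP * 'X_1 ^+ 2.
Proof.
move=> /binary_form_expand ->.
exists g@_(bmon 2 0), g@_(bmon 2 1), g@_(bmon 2 2).
by rewrite !big_ord_recl big_ord0 -!mul_mpolyC /=; ring.
Qed.

(** * Repeated factors and zeros of forms *)

Lemma Delta_quartic_disc (F : fieldType) (f : {mpoly F[2]}) :
  Delta f = quartic_disc (qcoef f 0) (qcoef f 1) (qcoef f 2) (qcoef f 3) (qcoef f 4).
Proof. by []. Qed.

Lemma Delta_double_factor (F : fieldType) (a b k l m : F) (f : {mpoly F[2]}) :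
  3%:R = 0 :> F ->
  f = (a%:MP * 'X_0 + b%:MP * 'X_1) ^+ 2
      * (k%:MP * 'X_0 ^+ 2 + l%:MP * ('X_0 * 'X_1) + m%:MP * 'X_1 ^+ 2) ->
  Delta f = 0.
Proof.
move=> h3 fE.
pose z := nth 0 [:: a ^+ 2 * k; a ^+ 2 * l + 2%:R * a * b * k;
  a ^+ 2 * m + 2%:R * a * b * l + b ^+ 2 * k; 2%:R * a * b * m + b ^+ 2 * l; b ^+ 2 * m].
have -> : f = \sum_(i < 5) z i *: ('X_0 ^+ (4 - i) * 'X_1 ^+ i).
  rewrite fE !big_ord_recl big_ord0 /z /= -!mul_mpolyC.
  by rewrite !(rmorphD, rmorphM, rmorphXn, rmorph_nat) /=; ring.
rewrite Delta_quartic_disc !qcoef_sum // /z /= /quartic_disc.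
have h2 : 2%:R = -1 :> F by rewrite !(char3_numerals h3).
(* With c the coefficient of X^2 Y^2, z0 z4 - z1 z3 is w c and the last bracket of [Delta] is w^3 +
   w^2 c, so that everything cancels. *)
rewrite h2; set c := a ^+ 2 * m + _ + _; pose w := a * b * l.
rewrite (_ : _ * _ - _ * _ = w * c); last by rewrite /c /w; ring_char3 h3.
rewrite (_ : _ + _ - a ^+ 2 * k * c * _ = w ^+ 3 + w ^+ 2 * c).
  by ring.
by rewrite /c /w; ring_char3 h3.
Qed.

Lemma row2P (R : Type) (v w : 'rV[R]_2) :
  v 0 0 = w 0 0 -> v 0 1 = w 0 1 -> v = w.
Proof.
move=> e0 e1; apply/rowP => i; have [->|->] // : i = 0 \/ i = 1.
by case: i => [[|[|//]] i]; [left | right]; apply: val_inj.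
Qed.

(** At (1 : 0) the coefficient of X^d vanishes, so Y divides g. At (t : 1) the divisor is L = X - t
    Y, since X^i and (t Y)^i agree modulo L. *)
Lemma root_linear_factor (F : finFieldType) d (g : {mpoly F[2]}) (v : 'rV[F]_2) :
  g \is d.-homog -> v != 0 -> form_eval g v = 0 ->
  exists L h, [/\ L \is 1.-homog, L != 0 & g = L * h].
Proof.
move=> gd v0 gv; have X1 i : ('X_i : {mpoly F[2]}) \is 1.-homog by rewrite dhomogX /= mdeg1.
move: gv; rewrite (form_eval_binary v gd) => gv.
have [y0|y0] := eqVneq (v 0 1) 0.
  have x0 : v 0 0 != 0.
    apply: contraNneq v0 => x0; by apply/eqP/row2P; rewrite mxE.
  exists 'X_1, (\sum_(i < d) g@_(bmon d i.+1) *: ('X_0 ^+ (d - i.+1) * 'X_1 ^+ i)).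
  split; [exact: X1 | by rewrite -msupp_eq0 msuppX | ].
  move: gv; rewrite big_ord_recl big1 => [|i _]; last first.
    by rewrite y0 exprS mul0r !mulr0.
  rewrite /= addr0 subn0 expr0 mulr1 => /eqP.
  rewrite mulf_eq0 expf_eq0 (negPf x0) andbF orbF => /eqP c0.
  rewrite {1}(binary_form_expand gd) big_ord_recl c0 scale0r add0r big_distrr.
  by apply: eq_bigr => i _; rewrite /= -!mul_mpolyC exprS; ring.
pose t := v 0 0 / v 0 1.
pose L : {mpoly F[2]} := 'X_0 - t *: 'X_1.
have L0 : L != 0.
  apply: contraTneq (oner_neq0 F) => L0; apply/negPn/eqP.
  transitivity L@_U_(0%R); last by rewrite L0 mcoeff0.
  by rewrite mcoeffB mcoeffZ !mcoeffXU eqxx mulr0 subr0.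
have divL i : exists q, 'X_0 ^+ i = (t *: 'X_1) ^+ i + L * q :> {mpoly F[2]}.
  by eexists; apply/eqP; rewrite addrC -subr_eq subrXX.
have div : exists q, forall i : 'I_d.+1,
    'X_0 ^+ (d - i) = (t *: 'X_1) ^+ (d - i) + L * q i :> {mpoly F[2]}.
  have [q qE] := fin_all_exists (fun i : 'I_d.+1 => divL (d - i)%N).
  by exists q.
have [q qE] := div.
exists L, (\sum_(i < d.+1) g@_(bmon d i) *: (q i * 'X_1 ^+ i)).
split=> //; first by rewrite /L rpredB ?rpredZ // X1.
rewrite {1}(binary_form_expand gd) big_distrr /=.
apply/eqP; rewrite -subr_eq0 -sumrB.
(* The remainder modulo L is g(t, 1) Y^d, and g(t, 1) times y^d is the value of g at v. *)
have zero : (\sum_(i < d.+1) g@_(bmon d i) * t ^+ (d - i)) *: 'X_1 ^+ d = 0 :> {mpoly F[2]}.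
  rewrite (_ : \sum_(i < _) _ = 0) ?scale0r //.
  apply: (mulIf (expf_neq0 d y0)); rewrite mul0r -[RHS]gv big_distrl.
  apply: eq_bigr => i _; rewrite /= /t expr_div_n -mulrA; congr (_ * _).
  rewrite (_ : v 0 1 ^+ d = v 0 1 ^+ (d - i) * v 0 1 ^+ i).
    by rewrite mulrA divfK ?expf_neq0.
  by rewrite -exprD subnK // -ltnS.
rewrite -[X in _ == X]zero scaler_suml; apply/eqP/eq_bigr => i _.
rewrite (_ : 'X_1 ^+ d = 'X_1 ^+ (d - i) * 'X_1 ^+ i :> {mpoly F[2]}).
  by rewrite qE exprZn -!mul_mpolyC mpolyCM; ring.
by rewrite -exprD subnK // -ltnS.
Qed.

Lemma homog_unit (F : fieldType) n d (g : {mpoly F[n]}) :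
  g \is d.-homog -> g \is a GRing.unit -> d = 0%N.
Proof.
move=> gd gu; apply: (dhomog_uniq _ gd); first by apply: contraTneq gu => ->; rewrite unitr0.
case/andP: gu => /eqP -> _; rewrite -[_%:MP]mulr1 mul_mpolyC rpredZ //.
exact: dhomog1.
Qed.

(** A zero would split off a linear form with a constant cofactor, forcing degree 1. *)
Lemma mirreducible_zeros (F : finFieldType) d (g : {mpoly F[2]}) :
  g \is d.-homog -> mirreducible g -> (1 < d)%N -> proj_zeros g = set0.
Proof.
move=> gd [g0 _ irr] d1; apply/setP=> P; rewrite !inE; apply/negP.
case/andP => /imsetP[w]; rewrite inE => w0 -> /existsP[v /andP[/imsetP[c]]].
rewrite inE => c0 -> /eqP gv.
have v0 : c *: w != 0 by rewrite scaler_eq0 negb_or c0.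
have [L [h [L1 L0 gE]]] := root_linear_factor gd v0 gv.
case: (irr L h gE) => [/(homog_unit L1) // | /andP[/eqP hE _]].
have g1 : g \is 1.-homog by rewrite gE hE mulrC mul_mpolyC rpredZ.
by rewrite (dhomog_uniq g0 gd g1) in d1.
Qed.

Lemma proj_zerosM (F : finFieldType) n (g h : {mpoly F[n.+1]}) :
  proj_zeros (g * h) = proj_zeros g :|: proj_zeros h.
Proof.
apply/setP=> P; rewrite !inE -andb_orr; congr (_ && _).
have ghE v : (form_eval (g * h) v == 0) = (form_eval g v == 0) || (form_eval h v == 0).
  by rewrite /form_eval mevalM mulf_eq0.
apply/existsP/orP => [[v]|].
  by rewrite ghE andb_orr => /orP[Pv|Pv]; [left | right]; apply/existsP; exists v.
by case=> /existsP[v /andP[Pv ghv]]; exists v; rewrite Pv ghE ghv ?orbT.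
Qed.

Lemma linear_zeros (F : finFieldType) (g : {mpoly F[2]}) :
  g \is 1.-homog -> g != 0 -> exists P, proj_zeros g = [set P].
Proof.
move=> /linear_formE[a [b gE]] g0.
have ev v : form_eval g v = a * v 0 0 + b * v 0 1.
  by rewrite gE /form_eval mevalD !mevalM !mevalC !mevalXU.
(* The zero of a X + b Y is (b : -a). *)
pose w : 'rV[F]_2 := \row_i if i == 0 then b else - a.
have w0 : w != 0.
  apply: contraNneq g0 => /rowP w0; move: (w0 0) (w0 1); rewrite !mxE /= => b0 /eqP.
  by rewrite oppr_eq0 => /eqP a0; rewrite gE a0 b0 !mul0r addr0.
exists (proj_point w); apply/setP=> P; rewrite !inE; apply/idP/eqP => [|->].
  case/andP => /imsetP[u]; rewrite inE => u0 -> /existsP[v /andP[vu /eqP]].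
  have v0 : v != 0.
    case/imsetP: vu => c; rewrite inE => c0 ->.
    by rewrite scaler_eq0 negb_or c0.
  move: vu; rewrite -eq_proj_point => /eqP <-; rewrite ev => gv.
  apply/eqP; rewrite eq_proj_point.
  suff [c vE] : exists c, v = c *: w.
    by apply/imsetP; exists c; rewrite // inE; apply: contraNneq v0 => c0; rewrite vE c0 scale0r.
  have [b0|b0] := eqVneq b 0.
    have a0 : a != 0.
      by apply: contraNneq w0 => a0; apply/eqP/row2P; rewrite !mxE /= ?a0 ?b0 ?oppr0.
    exists (- v 0 1 / a); move/eqP: gv; rewrite b0 mul0r addr0 mulf_eq0 (negPf a0).
    by move=> /eqP x0; apply/row2P; rewrite !mxE /= ?x0 ?b0 ?mulr0 //; field.
  exists (v 0 0 / b); apply/row2P; rewrite !mxE /=; first by rewrite divfK.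
  apply: (mulfI b0); rewrite -[LHS](addKr (a * v 0 0)) gv; field.
  exact: b0.
apply/andP; split; first by apply: imset_f; rewrite inE.
apply/existsP; exists w; rewrite proj_point_refl ev !mxE /=.
by apply/eqP; ring.
Qed.

(** Two linear forms with a common zero have determinant a d - b c = 0, so g2 is a multiple of g1
    and g1^2 divides f. *)
Lemma Delta_common_zero (F : finFieldType) (g1 g2 h f : {mpoly F[2]}) P :
  3%:R = 0 :> F -> g1 \is 1.-homog -> g1 != 0 -> g2 \is 1.-homog -> h \is 2.-homog ->
  f = g1 * g2 * h -> P \in proj_zeros g1 -> P \in proj_zeros g2 -> Delta f = 0.
Proof.
move=> h3 /linear_formE[a [b g1E]] g10 /linear_formE[c [d g2E]] /quadratic_formE[k [l [m hE]]].
move=> fE; rewrite !inE => /andP[/imsetP[u]]; rewrite inE => u0 -> /existsP[v /andP[vu /eqP g1v]].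
case/andP => _ /existsP[v' /andP[/imsetP[e']]]; rewrite inE => e'0 -> /eqP g2v.
case/imsetP: vu g1v => e; rewrite inE => e0 ->.
have ev (x y z : F) : z != 0 -> form_eval (x%:MP * 'X_0 + y%:MP * 'X_1) (z *: u) = 0 ->
    x * u 0 0 + y * u 0 1 = 0.
  move=> z0; rewrite /form_eval mevalD !mevalM !mevalC !mevalXU !mxE => E.
  by apply: (mulfI z0); rewrite mulr0 -E; ring.
move: g2v; rewrite g1E g2E => /(ev _ _ _ e'0) gu2 /(ev _ _ _ e0) gu1.
have ad : a * d = b * c.
  have [x0|x0] := eqVneq (u 0 0) 0.
    have y0 : u 0 1 != 0.
      by apply: contraNneq u0 => y0; apply/eqP/row2P; rewrite mxE.
    apply/(mulIf y0)/eqP; rewrite -subr_eq0; apply/eqP.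
    transitivity (a * (c * u 0 0 + d * u 0 1) - c * (a * u 0 0 + b * u 0 1)).
      by ring.
    by rewrite gu1 gu2 !mulr0 subr0.
  apply/(mulIf x0)/eqP; rewrite -subr_eq0; apply/eqP.
  transitivity (d * (a * u 0 0 + b * u 0 1) - b * (c * u 0 0 + d * u 0 1)).
    by ring.
  by rewrite gu1 gu2 !mulr0 subr0.
suff [t [ct dt]] : exists t, c = t * a /\ d = t * b.
  apply: (@Delta_double_factor _ a b (t * k) (t * l) (t * m)) => //.
  by rewrite fE g1E g2E hE ct dt !mpolyCM; ring.
have [a0|a0] := eqVneq a 0.
  have b0 : b != 0.
    by apply: contraNneq g10 => b0; rewrite g1E a0 b0 !mul0r addr0.
  exists (d / b); rewrite divfK //; split=> //; move/eqP: ad.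
  by rewrite a0 mul0r mulr0 eq_sym mulf_eq0 (negPf b0) => /eqP.
exists (c / a); rewrite divfK //; split=> //.
by apply: (mulfI a0); rewrite ad; field.
Qed.

(** * The value of [zeta] for each factorization type *)

Lemma zeta_card_E_points (F : finFieldType) (f : {mpoly F[2]}) :
  3%:R = 0 :> F -> f \is 4.-homog -> Delta f != 0 -> qcoef f 2 = 1 ->
  (2 * zeta f + #|proj_zeros f|)%N = #|E_points (jinv f)|.
Proof.
move=> h3 f4 D0 f2; have n2 := char3_two_neq0 h3.
have discE : quartic_disc (qcoef f 0) (qcoef f 1) 1 (qcoef f 3) (qcoef f 4) = Delta f.
  by rewrite -f2.
rewrite (zeta_npoints n2 (fun v => form_eval_quartic v f4)) card_E_points.
(* As the coefficient of X^2 Y^2 is 1, the inverse of [jinv f] is [Delta f]. *)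
by rewrite /jinv f2 expr1n div1r invrK npoints_ncurve // discE.
Qed.

Theorem theorem5p1 (F : finFieldType) (q k : nat)
    (hq : q = (3 ^ k)%N) (hF : #|F| = q)
    (f : {mpoly F[2]}) (r : F)
    (hf : f \is 4.-homog)
    (hDelta : Delta f != 0)
    (hj : jinv f = r) (hr : r != 0)
    (hnorm : qcoef f 2 = 1) :
  [/\ F1 f -> (zeta f)%:R = ((#|E_points r|)%:R - 1%:R) / 2%:R :> rat,
      F2 f -> (zeta f)%:R = ((#|E_points r|)%:R - 2%:R) / 2%:R :> rat,
      F4 f -> (zeta f)%:R = ((#|E_points r|)%:R - 4%:R) / 2%:R :> rat
    & F2' f \/ F4' f -> (zeta f)%:R = (#|E_points r|)%:R / 2%:R :> rat].
Proof.
have h3 : 3%:R = 0 :> F.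
  apply: pcharf0; apply: (@card_finPcharP _ 3 k) => //.
  by rewrite hF hq.
have E := zeta_card_E_points h3 hf hDelta hnorm; rewrite hj in E.
(* It remains to count the zeros of f in each case. *)
have zetaE i : #|proj_zeros f| = i ->
    (zeta f)%:R = ((#|E_points r|)%:R - i%:R) / 2%:R :> rat.
  by move=> zf; rewrite -E zf natrD natrM addrK mulrC mulKf.
have zeros_neq (g1 g2 h : {mpoly F[2]}) P1 P2 : g1 \is 1.-homog -> mirreducible g1 ->
    g2 \is 1.-homog -> h \is 2.-homog -> f = g1 * g2 * h ->
    proj_zeros g1 = [set P1] -> proj_zeros g2 = [set P2] -> P1 != P2.
  move=> g1h [g10 _ _] g2h hh fE z1 z2; apply: contraNneq hDelta => P12.
  apply/eqP; apply: (Delta_common_zero (P := P1) h3 g1h g10 g2h hh fE).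
    by rewrite z1 set11.
  by rewrite z2 P12 set11.
have lin (g : {mpoly F[2]}) : g \is 1.-homog -> mirreducible g -> exists P, proj_zeros g = [set P].
  by move=> gh [g0 _ _]; apply: linear_zeros.
split.
- case=> gs []; case: gs => [|g1 [|g2 [|? ?]]] //= _ hg fE; apply: zetaE.
  have [[g1h i1] [g2h i2]] := (hg 0%N isT, hg 1%N isT).
  have [P1 z1] := lin _ g1h i1.
  rewrite fE !big_cons big_nil mulr1 proj_zerosM z1.
  by rewrite (mirreducible_zeros g2h i2) // setU0 cards1.
- case=> gs []; case: gs => [|g1 [|g2 [|g3 [|? ?]]]] //= _ hg fE; apply: zetaE.
  have [[g1h i1] [g2h i2]] := (hg 0%N isT, hg 1%N isT).
  have [g3h i3] := hg 2%N isT.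
  have [[P1 z1] [P2 z2]] := (lin _ g1h i1, lin _ g2h i2).
  have P12 : P1 != P2.
    apply: (zeros_neq g1 g2 g3) => //.
    by rewrite fE !big_cons big_nil mulr1 mulrA.
  rewrite fE !big_cons big_nil mulr1 !proj_zerosM z1 z2.
  by rewrite (mirreducible_zeros g3h i3) // setU0 cards2 P12.
- case=> gs []; case: gs => [|g1 [|g2 [|g3 [|g4 [|? ?]]]]] //= _ hg fE; apply: zetaE.
  have [[g1h i1] [g2h i2]] := (hg 0%N isT, hg 1%N isT).
  have [[g3h i3] [g4h i4]] := (hg 2%N isT, hg 3%N isT).
  have [[P1 z1] [P2 z2]] := (lin _ g1h i1, lin _ g2h i2).
  have [[P3 z3] [P4 z4]] := (lin _ g3h i3, lin _ g4h i4).
  rewrite !big_cons big_nil mulr1 in fE.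
  (* For each pair of linear factors, the product of the other two serves as the quadratic
     cofactor. *)
  have P12 : P1 != P2.
    by apply: (zeros_neq g1 g2 (g3 * g4)) => //; rewrite ?(dhomogM g3h) // fE; ring.
  have P13 : P1 != P3.
    by apply: (zeros_neq g1 g3 (g2 * g4)) => //; rewrite ?(dhomogM g2h) // fE; ring.
  have P14 : P1 != P4.
    by apply: (zeros_neq g1 g4 (g2 * g3)) => //; rewrite ?(dhomogM g2h) // fE; ring.
  have P23 : P2 != P3.
    by apply: (zeros_neq g2 g3 (g1 * g4)) => //; rewrite ?(dhomogM g1h) // fE; ring.
  have P24 : P2 != P4.
    by apply: (zeros_neq g2 g4 (g1 * g3)) => //; rewrite ?(dhomogM g1h) // fE; ring.
  have P34 : P3 != P4.
    by apply: (zeros_neq g3 g4 (g1 * g2)) => //; rewrite ?(dhomogM g1h) // fE; ring.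
  rewrite fE !proj_zerosM z1 z2 z3 z4 !cardsU1 cards1 !inE !negb_or.
  by rewrite P12 P13 P14 P23 P24 P34.
- move=> F24; have := zetaE 0%N; rewrite subr0; apply; case: F24.
    case=> gs []; case: gs => [|g [|? ?]] //= _ hg ->; have [gh ig] := hg 0%N isT.
    by rewrite big_cons big_nil mulr1 (mirreducible_zeros gh ig) ?cards0.
  case=> gs []; case: gs => [|g1 [|g2 [|? ?]]] //= _ hg ->.
  have [[g1h i1] [g2h i2]] := (hg 0%N isT, hg 1%N isT).
  rewrite !big_cons big_nil mulr1 proj_zerosM.
  by rewrite (mirreducible_zeros g1h i1) ?(mirreducible_zeros g2h i2) ?setU0 ?cards0.
Qed.
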